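(* Assume $\Delta=\sup_{x,y\in\mathbb R^k}|\ell(x)-\ell(y)|<\infty$. For any $\epsilon>0$ and any threshold $b>2$, let $h(\epsilon,\Delta)=\min\{\frac{\epsilon}{2\Delta},1\}$. Then the DP-CUSUM stopping time $\tilde T(b)$ satisfies $$\mathbf E_\infty[\tilde T(b)]\ge\frac{e^{h(\epsilon,\Delta)\,b-2}}{4(b+1)^2}.$$
   Context: Let $f_0\ne f_1$ be two known distinct probability density functions on $\mathbb R^k$ (pre- and post-change densities) and let $\ell(x)=\log(f_1(x)/f_0(x))$ be the log-likelihood ratio. For a data sequence $X_1,X_2,\ldots\in\mathbb R^k$, the CUSUM statistics are $S_0=0$ and, for $t\ge1$, $$S_t=\max_{1\le k\le t}\sum_{j=k}^t\ell(X_j)=\max(0,S_{t-1})+\ell(X_t).$$ $\mathrm{Lap}(\beta)$ denotes the Laplace distribution with density $\exp(-|x|/\beta)/(2\beta)$, $\beta>0$. The DP-CUSUM procedure uses $\tilde S_t=S_t+Z_t$, where $Z_1,Z_2,\ldots$ are i.i.d. $\mathrm{Lap}(2\Delta/\epsilon)$, and a single $W\sim\mathrm{Lap}(2\Delta/\epsilon)$; $(Z_t)_{t\ge1}$, $W$ and the data are mutually independent. The stopping time with deterministic threshold $b$ is $$\tilde T(b)=\inf\{t>0:\tilde S_t\ge b+W\}.$$ $\mathbf E_\infty$ denotes expectation under the joint law in which $X_1,X_2,\ldots$ are i.i.d. with density $f_0$ (no change occurs), together with the Laplace noises $(Z_t)$ and $W$ above. *)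

(* Defs.v *)
From HB Require Import structures.
From mathcomp Require Import all_boot all_order all_algebra finmap.
From mathcomp Require Import all_classical all_reals all_analysis.

Set Implicit Arguments.
Unset Strict Implicit.
Unset Printing Implicit Defensive.

Import Order.TTheory GRing.Theory Num.Theory.
Import numFieldNormedType.Exports.

Local Open Scope classical_set_scope.
Local Open Scope ring_scope.

(* R^k is [k.-tuple R], with the sigma-algebra generated by the coordinates,
   which is the Borel one. *)

Section lebesgue_tuple.
Variable R : realType.

Definition cons_pair (k : nat) (p : k.-tuple R * R) : k.+1.-tuple R :=
  [tuple of p.2 :: p.1].

Lemma measurable_cons_pair (k : nat) :
  measurable_fun [set: k.-tuple R * R] (@cons_pair k).
Proof. exact: measurable_cons. Qed.

(* The head constant of the successor case is the canonical measure structure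
   of [pushforward], which needs the measurability proof explicitly. *)
Fixpoint lebesgue_tuple (k : nat) : {measure set (k.-tuple R) -> \bar R} :=
  match k with
  | 0%N => [the {measure set _ -> \bar R} of \d_([tuple] : 0.-tuple R)]
  | k'.+1 => measure_function_pushforward__canonical__measure_function_Measure
      [the {measure set _ -> \bar R} of
        (lebesgue_tuple k' \x lebesgue_measure)%E]
      (@measurable_cons_pair k')
  end.

Lemma lebesgue_tuple_box (k : nat) (A : 'I_k -> set R) :
  (forall i, measurable (A i)) ->
  lebesgue_tuple k [set x | forall i, A i (tnth x i)] =
  (\prod_(i < k) lebesgue_measure (A i))%E.
Proof.
elim: k A => [|k IH] A mA.
  rewrite big_ord0 /= diracE mem_set//.
  by case.
rewrite big_ord_recl /= /pushforward.
have -> : @cons_pair k @^-1` [set x | forall i, A i (tnth x i)] =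
    [set x | forall i, A (lift ord0 i) (tnth x i)] `*` A ord0.
  apply/seteqP; split => [[x y]/= H|[x y]/= [Hx Hy] i].
    split; last by have := H ord0; rewrite /cons_pair tnth0.
    by move=> i; have := H (lift ord0 i); rewrite /cons_pair tnthS.
  rewrite /cons_pair; case: (unliftP ord0 i) => [j|] ->.
    by rewrite tnthS.
  by rewrite tnth0.
have box : measurable
    [set x : k.-tuple R | forall i, A (lift ord0 i) (tnth x i)].
  rewrite (_ : [set x | _] = \bigcap_(i in [set: 'I_k])
      ((fun x : k.-tuple R => tnth x i) @^-1` A (lift ord0 i))); last first.
    by apply/seteqP; split => x /= H i; [move=> _|]; apply: H.
  apply: fin_bigcap_measurable; first exact: finite_finset.
  move=> i _; rewrite -[X in measurable X]setTI.
  exact: (@measurable_tnth _ R k i measurableT _ (mA _)).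
rewrite product_measure1E; [|exact: box|exact: (mA ord0)].
rewrite muleC; congr (_ * _)%E.
exact: (IH (fun i => A (lift ord0 i))).
Qed.

End lebesgue_tuple.

Section density.
Local Open Scope ereal_scope.
Context {R : realType} {d : measure_display} {T : measurableType d}.

Definition is_pdf (mu : {measure set T -> \bar R}) (f : T -> R) : Prop :=
  [/\ measurable_fun [set: T] f, (forall x, (0 <= f x)%R) &
      \int[mu]_x (f x)%:E = 1].

Definition has_density (mu : {measure set T -> \bar R}) (f : T -> R)
    {d' : measure_display} {Omega : measurableType d'}
    (P : probability Omega R) (X : Omega -> T) : Prop :=
  forall A, measurable A -> P (X @^-1` A) = \int[mu]_(x in A) (f x)%:E.

End density.

Definition laplace_pdf {R : realType} (beta x : R) : R :=
  expR (- (`|x| / beta)) / (2 * beta).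

Section independence.
Context {R : realType} {d : measure_display} {Omega : measurableType d}.

Definition mutually_independent (P : probability Omega R) (I : choiceType)
    (F : I -> set (set Omega)) : Prop :=
  forall (J : {fset I}) (E : I -> set Omega),
    (forall i, i \in J -> F i (E i)) ->
    P (\bigcap_(i in [set` J]) E i) = (\prod_(i <- J) P (E i))%E.

End independence.

Section cusum.
Context {R : realType} {k : nat}.
Local Open Scope ereal_scope.

(* Extended real-valued, so that no positivity of the densities is assumed:
   where [f0 x = 0] or [f1 x = 0] the value is infinite (0 / 0 = 0 in [\bar R]
   and [lne 0 = -oo]); elsewhere it is [ln (f1 x / f0 x)]. *)
Definition llr (f0 f1 : k.-tuple R -> R) (x : k.-tuple R) : \bar R :=
  lne ((f1 x)%:E / (f0 x)%:E).

(* A point where [l] is infinite makes the supremum [+oo], because of the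
   term x = y: [`|+oo - +oo| = `|-oo - -oo| = +oo] in [\bar R]. *)
Definition oscillation (l : k.-tuple R -> \bar R) : \bar R :=
  ereal_sup [set `|l x - l y|
    | x in [set: k.-tuple R] & y in [set: k.-tuple R]].

Lemma oscillation_fin (l : k.-tuple R -> \bar R) (D : R) :
  oscillation l = D%:E -> forall x, l x \is a fin_num.
Proof.
move=> lD x; have : `|l x - l x| <= D%:E.
  by rewrite -lD; apply: ereal_sup_ubound; exists x => //; exists x.
by case: (l x).
Qed.

Lemma llr_finE (f0 f1 : k.-tuple R -> R) (x : k.-tuple R) :
  (0 <= f0 x)%R -> (0 <= f1 x)%R -> llr f0 f1 x \is a fin_num ->
  [/\ (0 < f0 x)%R, (0 < f1 x)%R & llr f0 f1 x = (ln (f1 x / f0 x))%:E].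
Proof.
rewrite /llr le_eqVlt => /predU1P[<-|f0x].
  rewrite le_eqVlt inve0 => /predU1P[<-|f1x]; first by rewrite mul0e /= lexx.
  by rewrite gt0_muley.
rewrite le_eqVlt => /predU1P[<-|f1x]; first by rewrite mul0e /= lexx.
by rewrite inver gt_eqF// -EFinM lne_EFin// divr_gt0.
Qed.

(* In this section a sequence is indexed from 1; its term at 0 is not used. *)
Definition cusum (l : k.-tuple R -> \bar R) (x : nat -> k.-tuple R)
    (t : nat) : \bar R :=
  if t == 0%N then 0
  else \big[maxe/-oo]_(1 <= j < t.+1) \sum_(j <= i < t.+1) l (x i).

Lemma cusumS (l : k.-tuple R -> \bar R) (x : nat -> k.-tuple R) (t : nat) :
  (forall y, l y \is a fin_num) ->
  cusum l x t.+1 = maxe 0 (cusum l x t) + l (x t.+1).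
Proof.
move=> lfin; rewrite /cusum /=; case: t => [|t] /=.
  by rewrite !big_nat1 maxxx add0e.
rewrite big_nat_recr //= big_nat1 maxC -(fineK (lfin _)) adde_maxl add0e.
congr maxe; rewrite [RHS](@big_morph _ _ (fun y => y + _) -oo maxe _ maxe
  (fun y z => adde_maxl _ _ _))//.
apply: eq_big_nat => j /andP[_ jt]; rewrite big_nat_recr ?fineK//=.
exact: ltnW.
Qed.

Definition dp_cusum_time (l : k.-tuple R -> \bar R) (b : R)
    {Omega : Type} (X : nat -> Omega -> k.-tuple R) (Z : nat -> Omega -> R)
    (W : Omega -> R) (w : Omega) : \bar R :=
  ereal_inf [set t%:R%:E | t in [set t : nat | (0 < t)%N /\
    (b + W w)%:E <= cusum l (fun i => X i w) t + (Z t w)%:E]].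

Definition dp_cusum_sigma {d : measure_display} {Omega : measurableType d}
    (X : nat -> Omega -> k.-tuple R) (Z : nat -> Omega -> R) (W : Omega -> R)
    (i : option (nat + nat)) : set (set Omega) :=
  match i with
  | Some (inl t) => g_sigma_algebra_preimage (X t.+1)
  | Some (inr t) => g_sigma_algebra_preimage (Z t.+1)
  | None => g_sigma_algebra_preimage W
  end.

End cusum.

(* Main.v *)
Require Import Defs.
From HB Require Import structures.
From mathcomp Require Import all_boot all_order all_algebra finmap.
From mathcomp Require Import all_classical all_reals all_analysis.
From mathcomp Require Import measurable_realfun ring lra.

Set Implicit Arguments.
Unset Strict Implicit.
Unset Printing Implicit Defensive.

Import Order.TTheory GRing.Theory Num.Theory.
Import numFieldNormedType.Exports.

Local Open Scope classical_set_scope.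
Local Open Scope ring_scope.

(** The CUSUM satisfies S_(t+1) = max (0, S_t) + l(X_(t+1)), and under f0 the
    likelihood ratio exp (l(X)) has mean 1.  This gives P(S_t >= u) <= exp (- u)
    for every real u, by induction on t and without a maximal inequality:
    max (0, S_t) inherits the bound, because for u <= 0 the right-hand side is
    at least 1; and if P(U >= u) <= exp (- u) for all u and V is independent of
    U, conditioning on V gives P(U + V >= u) <= exp (- u) E[exp V].

    The same conditioning step, at an exponent theta <= 1 instead of 1, adds
    the two Laplace noises ([exp_tail_add]).  With beta the scale of the noise,
    bounding the noise by its absolute value costs a factor
    E[exp (theta |Z|)] = 1 / (1 - theta beta) for each of Z_t and W.  For
    h = min (1 / beta, 1) and theta = h b / (b + 1) this factor is at most
    b + 1, while theta b >= h b - 1.  Hence at each time t the alarm condition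
    S_t + Z_t - W >= b has probability at most (b + 1)^2 exp (- theta b)
    ([noisy_cusum_exp_tail]), which is below q = (b + 1)^2 exp (2 - h b).

    A union bound finishes the proof: no alarm occurs up to time n with
    probability at least 1 - n q, so E[T] >= (n + 1) (1 - n q), and
    n = floor (1 / (2 q)) gives E[T] >= 1 / (4 q), which is the claimed bound
    ([expected_hitting_time_ge]).

    The independence of S_t from X_(t+1), Z_t and W is derived from the mutual
    independence of the generated sigma-algebras by the pi-lambda theorem
    ([mutually_independent_group]). *)

(** * Expectation against a density *)

Section integral_density.
Local Open Scope ereal_scope.
Context {R : realType} {d : measure_display} {T : measurableType d}.
Variables (mu nu : {measure set T -> \bar R}) (f : T -> R).
Hypothesis mf : measurable_fun [set: T] f.
Hypothesis f0 : forall x, (0 <= f x)%R.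
Hypothesis nuE : forall A, measurable A -> nu A = \int[mu]_(x in A) (f x)%:E.

Import HBNNSimple.

Let integral_density_nnsfun (h : {nnsfun T >-> R}) :
  \int[nu]_x (h x)%:E = \int[mu]_x ((h x)%:E * (f x)%:E).
Proof.
under [LHS]eq_integral do rewrite fimfunE -fsumEFin//.
rewrite [LHS]ge0_integral_fsum//; last 2 first.
  - by move=> r; exact/measurable_EFinP/measurableT_comp.
  - by move=> n x _; rewrite EFinM nnfun_muleindic_ge0.
under [RHS]eq_integral.
  move=> x xD; rewrite fimfunE -fsumEFin// ge0_mule_fsuml; last first.
    by move=> r; rewrite EFinM nnfun_muleindic_ge0.
  over.
rewrite [RHS]ge0_integral_fsum//; last 2 first.
  - move=> r; apply: emeasurable_funM; last exact/measurable_EFinP.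
    by apply/measurable_EFinP/measurableT_comp.
  - move=> n x _; rewrite mule_ge0//; last by rewrite lee_fin.
    by rewrite EFinM nnfun_muleindic_ge0.
apply: eq_fsbigr => r; rewrite inE => -[x _ hxr].
have r0 : (0 <= r)%R by rewrite -hxr.
under [LHS]eq_integral do rewrite EFinM.
rewrite integralZl_indic_nnsfun//= integral_indic//= setIT nuE//.
under [RHS]eq_integral do rewrite EFinM -muleA.
rewrite [RHS]ge0_integralZl//.
- congr (_ * _); rewrite integral_mkcond/=; apply: eq_integral => y _.
  by rewrite patchE indicE; case: ifPn => _; rewrite ?mul1e ?mul0e.
- apply: emeasurable_funM; last exact/measurable_EFinP.
  exact/measurable_EFinP/measurable_indic.
- by move=> y _; rewrite mule_ge0// lee_fin.
Qed.

(** Monotone convergence from simple functions; a Radon-Nikodym change of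
    variables would require [mu] to be sigma-finite. *)
Lemma ge0_integral_density (g : T -> \bar R) :
  measurable_fun [set: T] g -> (forall x, 0 <= g x) ->
  \int[nu]_x g x = \int[mu]_x (g x * (f x)%:E).
Proof.
move=> mg g0.
pose g_ := nnsfun_approx measurableT mg.
have cvg_g x : (g_ n x)%:E @[n --> \oo] --> g x by exact: cvg_nnsfun_approx.
have nd_g x : {homo (fun n => g_ n x) : m n / (m <= n)%N >-> (m <= n)%R}.
  by move=> m n mn; exact/lefP/nd_nnsfun_approx.
transitivity (lim (\int[nu]_x (g_ n x)%:E @[n --> \oo])).
  rewrite -monotone_convergence//=.
  - by apply: eq_integral => x _; apply/esym/cvg_lim.
  - by move=> n; exact/measurable_EFinP/measurable_funTS.
  - by move=> n ? _; rewrite lee_fin.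
  - by move=> x _ m n mn; rewrite lee_fin; exact: nd_g.
under eq_fun do rewrite integral_density_nnsfun.
rewrite -monotone_convergence//=.
- apply: eq_integral => x _; apply/cvg_lim => //.
  exact: cvgeZr.
- move=> n; apply: emeasurable_funM; last exact/measurable_EFinP.
  exact/measurable_EFinP/measurable_funTS.
- by move=> n x _; rewrite mule_ge0// lee_fin.
- move=> x _ m n mn; apply: lee_wpmul2r; first by rewrite lee_fin.
  by rewrite lee_fin; exact: nd_g.
Qed.

End integral_density.

Lemma has_density_expectation {R : realType} {d d' : measure_display}
    {T : measurableType d} {Omega : measurableType d'}
    (mu : {measure set T -> \bar R}) (f : T -> R) (P : probability Omega R)
    (X : Omega -> T) (g : T -> \bar R) :
  measurable_fun [set: Omega] X ->
  measurable_fun [set: T] f -> (forall x, 0 <= f x) -> has_density mu f P X ->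
  measurable_fun [set: T] g -> (forall x, (0 <= g x)%E) ->
  (\int[P]_w g (X w) = \int[mu]_x (g x * (f x)%:E))%E.
Proof.
move=> mX mf f0 fX mg g0; pose X' : {RV P >-> T} := mfun_Sub (mem_set mX).
rewrite -(ge0_integral_density (nu := distribution P X') mf f0)//.
by rewrite ge0_integral_distribution.
Qed.

(** * Grouping independent sigma-algebras *)

Section independence_grouping.
Local Open Scope ereal_scope.
Context {R : realType} {d : measure_display} {Omega : measurableType d}.
Variables (P : probability Omega R) (I : choiceType).
Variable F : I -> set (set Omega).
Hypothesis Fm : forall i, F i `<=` measurable.
Hypothesis FT : forall i, F i setT.
Hypothesis FI : forall i, setI_closed (F i).
Hypothesis indepF : mutually_independent P F.

(** Finite intersections of events taken from the [F j] form a pi-system that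
    generates the sigma-algebra of the group, and the product rule on it is
    mutual independence itself. *)
Lemma mutually_independent_group (J : {fset I}) (i : I) (A B : set Omega) :
  i \notin J -> F i A -> <<s \bigcup_(j in [set` J]) F j >> B ->
  P (A `&` B) = P A * P B.
Proof.
move=> iJ FA.
have mA : measurable A by exact: Fm FA.
pose G := [set C | exists2 E : I -> set Omega, (forall j, j \in J -> F j (E j))
  & C = \bigcap_(j in [set` J]) E j].
have FG : \bigcup_(j in [set` J]) F j `<=` G.
  move=> C [j /= jJ FC]; exists (fun j' => if j' == j then C else setT).
    by move=> j' _; case: eqP => [->|].
  apply/seteqP; split=> [w Cw j' _|w /(_ j jJ)]; last by rewrite eqxx.
  by case: eqP.
have Gm : G `<=` measurable.
  move=> _ [E FE ->]; apply: fin_bigcap_measurable; first exact: finite_fset.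
  by move=> j jJ; apply: Fm; exact: FE.
have GI : setI_closed G.
  move=> _ _ [E FE ->] [E' FE' ->]; exists (fun j => E j `&` E' j).
    by move=> j jJ; apply: FI; [exact: FE|exact: FE'].
  by rewrite bigcapI.
have GT : G setT by exists (fun=> setT) => //; rewrite bigcapT.
have prodG C : G C -> P (C `&` A) = P A * P C.
  move=> [E FE ->].
  pose E' j := if j == i then A else E j.
  have E'J j : j \in J -> E' j = E j.
    by move=> jJ; rewrite /E'; case: eqP => // ji; rewrite -ji jJ in iJ.
  have FE' j : j \in (i |` J)%fset -> F j (E' j).
    by rewrite /E' in_fset1U; case: eqP => [->//|_ /=]; exact: FE.
  have := indepF FE'; rewrite big_fsetU1//=.
  have -> : \prod_(j <- J) P (E' j) = P (\bigcap_(j in [set` J]) E j).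
    by rewrite (indepF FE); apply: eq_big_seq => j jJ; rewrite E'J.
  rewrite {2}/E' eqxx => <-; congr (P _).
  apply/seteqP; split=> [w [JE Aw] j /=|w H].
    rewrite in_fset1U /E'; case: eqP => //= _; exact: JE.
  split; last by have := H i; rewrite /E' eqxx; apply; rewrite /= fset1U1.
  by move=> j jJ; rewrite -E'J//; apply: H; rewrite /= fset1Ur.
have PAnum : P A \is a fin_num by exact: fin_num_measure.
have PA0 : (0 <= fine (P A))%R by exact: fine_ge0.
move=> sB.
have {sB} sB : <<s G >> B.
  by apply: sub_smallest2r sB; [exact: smallest_sigma_algebra|exact: FG].
have coverT : \bigcup_(n in [set: nat]) (fun=> [set: Omega]) n = [set: Omega].
  by rewrite bigcup_const//; exists 0%N.
rewrite setIC.
(* The two measures are C |-> P (C `&` A) and C |-> P A * P C. *)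
have := @g_sigma_algebra_measure_unique _ R _ G Gm (fun=> setT) (fun=> GT)
  coverT (mrestr P mA) (mscale (NngNum PA0) P) GI.
rewrite /mscale /= => restrE.
rewrite -[LHS]/(mrestr P mA B) restrE//.
- by rewrite /mscale/= fineK.
- by move=> C GC; rewrite /mscale/= fineK//; exact: prodG.
- by move=> _; rewrite /mrestr setTI ltey_eq PAnum.
Qed.

End independence_grouping.

(** * Exponential tails under addition of independent variables *)

Lemma measurable_superlevel {R : realType} {d : measure_display}
    {T : measurableType d} (f : T -> R) (c : R) :
  measurable_fun [set: T] f -> measurable [set x | c <= f x].
Proof.
move=> mf; rewrite (_ : [set x | _] = f @^-1` `[c, +oo[%classic).
  by rewrite -[X in measurable X]setTI; exact: mf.
by apply/seteqP; split => x /=; rewrite in_itv/= andbT.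
Qed.

Section tail.
Local Open Scope ereal_scope.
Context {R : realType} {d : measure_display} {Omega : measurableType d}.
Variable P : probability Omega R.

(** The bound is required for negative [u] too: this is what makes the class
    stable under addition without truncating the tail at probability 1. *)
Definition exp_tail (theta C : R) (U : Omega -> R) : Prop :=
  forall u : R, P [set w | (u <= U w)%R] <= (C * expR (- (theta * u)))%:E.

Definition independent_funs (U V : Omega -> R) : Prop :=
  forall A B : set R, measurable A -> measurable B ->
    P (V @^-1` A `&` U @^-1` B) = P (V @^-1` A) * P (U @^-1` B).

(** Conditionally on V = v, the event is U >= x - v, of probability at most
    C exp (- theta x) exp (theta v); integrate over the law of V. *)
Lemma exp_tail_add (theta C M : R) (U V : Omega -> R) :
  measurable_fun [set: Omega] U -> measurable_fun [set: Omega] V ->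
  independent_funs U V -> (0 <= C)%R -> exp_tail theta C U ->
  \int[P]_w (expR (theta * V w))%:E <= M%:E ->
  exp_tail theta (C * M) (U \+ V)%R.
Proof.
move=> mU mV UV C0 tU VM x.
pose U' : {RV P >-> R} := mfun_Sub (mem_set mU).
pose V' : {RV P >-> R} := mfun_Sub (mem_set mV).
have mVU : measurable_fun [set: Omega] (fun w => (V w, U w)).
  exact/measurable_fun_pairP.
pose m' :=
  measure_function_pushforward__canonical__measure_function_Measure P mVU.
pose D := [set p : R * R | (x <= p.2 + p.1)%R].
have mD : measurable D.
  apply: (@measurable_superlevel _ _ _ (fun p : R * R => (p.2 + p.1)%R)).
  exact: (measurable_funD measurable_snd measurable_fst).
have -> : P [set w | (x <= (U \+ V) w)%R] = m' D by [].
(* By independence the joint law is the product of the marginals. *)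
have <- : (distribution P V' \x distribution P U') D = m' D.
  by apply: product_measure_unique => // A B mA mB; exact: UV.
rewrite /product_measure1.
have mexp : measurable_fun [set: R] (fun v : R => (expR (theta * v))%:E).
  apply/measurable_EFinP; apply: measurableT_comp => //; exact: measurable_funM.
apply: (@le_trans _ _ (\int[distribution P V']_v
    ((C * expR (- (theta * x)))%:E * (expR (theta * v))%:E))).
  apply: ge0_le_integral => //.
  - exact: measurable_fun_xsection.
  - exact: emeasurable_funM.
  - move=> v _ /=; rewrite -EFinM -mulrA -expRD.
    have -> : (- (theta * x) + theta * v = - (theta * (x - v)))%R by ring.
    apply: le_trans (tU (x - v)%R).
    rewrite /distribution /pushforward/= le_eqVlt; apply/orP; left; apply/eqP.
    congr (P _); apply/seteqP.
    by split => w; rewrite /xsection /D /= inE /= lerBlDr.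
rewrite ge0_integralZl//; last by rewrite lee_fin mulr_ge0 ?expR_ge0.
rewrite [in leRHS]mulrAC [leRHS]EFinM lee_wpmul2l ?ge0_integral_distribution//.
by rewrite lee_fin mulr_ge0 ?expR_ge0.
Qed.

Lemma exp_tail_lower (theta theta' : R) (U : Omega -> R) :
  measurable_fun [set: Omega] U ->
  (0 <= theta' <= theta)%R -> exp_tail theta 1 U -> exp_tail theta' 1 U.
Proof.
move=> mU /andP[t0 tt] tU u; rewrite mul1r.
have [u0|u0] := leP 0%R u.
  apply: le_trans (tU u) _; rewrite mul1r lee_fin ler_expR lerN2.
  exact: ler_wpM2r.
apply: (@le_trans _ _ 1).
  by apply: probability_le1; exact: measurable_superlevel.
by rewrite lee_fin -expR0 ler_expR oppr_ge0 mulr_ge0_le0// ltW.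
Qed.

Lemma exp_tail_maxr0 (theta : R) (U : Omega -> R) :
  measurable_fun [set: Omega] U -> (0 <= theta)%R ->
  exp_tail theta 1 U -> exp_tail theta 1 (fun w => Num.max 0%R (U w)).
Proof.
move=> mU t0 tU u; rewrite mul1r.
have [u0|u0] := ltP 0%R u.
  rewrite (_ : [set w | _] = [set w | (u <= U w)%R]).
    by have := tU u; rewrite mul1r.
  by apply/seteqP; split => p /=; rewrite le_max leNgt u0.
apply: (@le_trans _ _ 1).
  apply: probability_le1; apply: measurable_superlevel.
  exact: (measurable_maxr (measurable_cst _) mU).
by rewrite lee_fin -expR0 ler_expR oppr_ge0 mulr_ge0_le0.
Qed.

End tail.

(** * Exponential moments of the Laplace distribution *)

(** On the half-line x >= 0 the integrand is a multiple of the exponential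
    density of rate (1 - theta beta) / beta. *)
Lemma integral_laplace_expR_abs {R : realType} (beta theta : R) :
  0 < beta -> 0 <= theta -> theta * beta < 1 ->
  (\int[lebesgue_measure]_x ((expR (theta * `|x|))%:E * (laplace_pdf beta x)%:E)
    = ((1 - theta * beta)^-1)%:E)%E.
Proof.
move=> b0 t0 tb1.
pose rate := (1 - theta * beta) / beta.
have r0 : 0 < rate by rewrite divr_gt0// subr_gt0.
under eq_integral do rewrite -EFinM.
rewrite (@ge0_symfun_integralT _
  (fun x => expR (theta * `|x|) * laplace_pdf beta x)); last 3 first.
- move=> x; rewrite mulr_ge0 ?expR_ge0// /laplace_pdf divr_ge0 ?expR_ge0//.
  by rewrite mulr_ge0// ltW.
- move=> x; apply: cvgM.
    apply: continuous_comp; last exact: continuous_expR.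
    by apply: cvgM; [exact: cvg_cst|exact: norm_continuous].
  apply: cvgM; last exact: cvg_cst.
  apply: (continuous_comp (f := fun x : R => - (`|x| / beta)));
    last exact: continuous_expR.
  by apply: cvgN; apply: cvgM; [exact: norm_continuous|exact: cvg_cst].
- by move=> x; rewrite /laplace_pdf /= normrN.
transitivity (2%:E * \int[lebesgue_measure]_(x in [set x : R | (0 <= x)%R])
    (((2 * (1 - theta * beta))^-1)%:E * (exponential_pdf rate x)%:E))%E.
  congr (_ * _)%E; apply: eq_integral => x; rewrite inE/= => x0.
  rewrite exponential_pdfE// ger0_norm// /laplace_pdf ger0_norm// -EFinM.
  rewrite mulrA -expRD (_ : theta * x + _ = - rate * x).
    congr EFin; rewrite /rate; field.
    by rewrite gt_eqF//= gt_eqF// subr_gt0.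
  by rewrite /rate; field; rewrite gt_eqF.
have m0 : measurable [set x : R | 0 <= x] by rewrite -set_itvcy.
have mexp : measurable_fun [set: R] (fun x => (exponential_pdf rate x)%:E).
  by apply/measurable_EFinP; exact: measurable_exponential_pdf.
rewrite ge0_integralZl//; last 3 first.
- exact: measurable_funTS.
- by move=> x _; rewrite lee_fin exponential_pdf_ge0// ltW.
- by rewrite lee_fin invr_ge0 mulr_ge0// subr_ge0 ltW.
rewrite integral_mkcond (_ : \int[_]_x _ = 1)%E.
  rewrite mule1 -EFinM; congr EFin; field.
  by rewrite gt_eqF// subr_gt0.
rewrite -[RHS](integral_exponential_pdf r0); apply: eq_integral => x _.
rewrite patchE; case: ifPn => //; rewrite notin_setE/= => /negP.
by rewrite -ltNge => x0; rewrite lt0_exponential_pdf.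
Qed.

(** [laplace_pdf 0] vanishes identically, since inversion sends 0 to 0, and so
    does not integrate to 1.  This is how a zero oscillation of the
    log-likelihood ratio is excluded. *)
Lemma laplace_scale_neq0 {R : realType} {d : measure_display}
    {Omega : measurableType d} (P : probability Omega R) (W : Omega -> R)
    (beta : R) :
  has_density lebesgue_measure (laplace_pdf beta) P W -> beta != 0.
Proof.
move=> W_law; apply/eqP => beta0.
have := W_law setT measurableT; rewrite preimage_setT probability_setT.
rewrite integral0_eq; first by move=> /eqP; rewrite onee_eq0.
by move=> x _; rewrite /laplace_pdf beta0 mulr0 invr0 !mulr0.
Qed.

Lemma measurable_laplace_pdf {R : realType} (beta : R) :
  measurable_fun [set: R] (laplace_pdf beta).
Proof.
apply: measurable_funM => //; apply: measurableT_comp => //.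
by apply: measurableT_comp => //; apply: measurable_funM.
Qed.

Lemma laplace_pdf_ge0 {R : realType} (beta x : R) :
  0 < beta -> 0 <= laplace_pdf beta x.
Proof. by move=> b0; rewrite divr_ge0 ?expR_ge0// mulr_ge0// ltW. Qed.

Lemma laplace_expectation_expR_abs {R : realType} {d : measure_display}
    {Omega : measurableType d} (P : probability Omega R) (V : {RV P >-> R})
    (beta theta : R) :
  0 < beta -> 0 <= theta -> theta * beta < 1 ->
  has_density lebesgue_measure (laplace_pdf beta) P V ->
  (\int[P]_w (expR (theta * `|V w|))%:E = ((1 - theta * beta)^-1)%:E)%E.
Proof.
move=> b0 t0 tb1 V_law.
rewrite -(integral_laplace_expR_abs b0 t0 tb1).
apply: (@has_density_expectation R _ _ (measurableTypeR R) Omega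
  lebesgue_measure (laplace_pdf beta) P V
  (fun x : R => (expR (theta * `|x|))%:E)).
- exact: (measurable_funPT V).
- exact: measurable_laplace_pdf.
- by move=> x; exact: laplace_pdf_ge0.
- exact: V_law.
- apply/measurable_EFinP; apply: measurableT_comp => //.
  exact: measurable_funM.
- by move=> x; rewrite lee_fin expR_ge0.
Qed.

(** * Mean hitting times by the union bound *)

Section hitting_time.
Local Open Scope ereal_scope.
Context {R : realType} {d : measure_display} {Omega : measurableType d}.

Import HBNNSimple.

(** Markov's inequality for a function [f] not known to be measurable: the
    integral of [f] is a supremum over the simple functions below it, and c times
    the indicator of [A] is one of them. *)
Lemma ge0_integral_ge_measurable_set (mu : {measure set Omega -> \bar R})
    (f : Omega -> \bar R) (A : set Omega) (c : R) :
  measurable A -> (forall w, 0 <= f w) -> (0 <= c)%R ->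
  (forall w, A w -> c%:E <= f w) -> c%:E * mu A <= \int[mu]_w f w.
Proof.
move=> mA f0 c0 cf.
rewrite -(sintegral_indic mu A) -(sintegralrM mu c (indic_nnsfun R mA)).
rewrite ge0_integralTE//; apply: ereal_sup_ubound => /=.
exists (scale_nnsfun (indic_nnsfun R mA) c0) => //= w.
rewrite mindicE; case: (asboolP (A w)) => [Aw|nAw].
  by rewrite mem_set// mulr1; exact: cf.
by rewrite memNset// mulr0.
Qed.

Variable P : probability Omega R.

(** With B t of probability at most q, none of B 1, ..., B n occurs with
    probability at least 1 - n q, and then the hitting time is at least
    n + 1. *)
Lemma expected_hitting_time_ge (B : nat -> set Omega) (q : R) :
  (0 < q)%R -> (forall t, measurable (B t)) ->
  (forall t, (0 < t)%N -> P (B t) <= q%:E) ->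
  ((4 * q)^-1)%:E <=
    \int[P]_w ereal_inf [set t%:R%:E | t in [set t | (0 < t)%N /\ B t w]].
Proof.
move=> q0 mB PB.
(* This n makes n + 1 >= 1 / (2 q) and 1 - n q >= 1 / 2 at once. *)
pose n := Num.truncn (2 * q)^-1.
have /andP[n_le n_lt] : (n%:R <= (2 * q)^-1 < n.+1%:R)%R.
  by apply: truncn_itv; rewrite invr_ge0 mulr_ge0// ltW.
pose U := \big[setU/set0]_(i < n) B i.+1.
have mU : measurable U by apply: bigsetU_measurable => i _.
have PU : P U <= (n%:R * q)%:E.
  apply: le_trans (Boole_inequality P (fun i _ => mB i.+1)) _.
  apply: (@le_trans _ _ (\sum_(i < n) q%:E)).
    by apply: lee_sum => i _; exact: PB.
  by rewrite sumEFin sumr_const card_ord mulr_natl.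
apply: (@le_trans _ _ (n.+1%:R%:E * P (~` U))); last first.
  apply: ge0_integral_ge_measurable_set => //.
  - exact: measurableC.
  - by move=> w; apply: le_ereal_inf_tmp => _ [t _ <-]; rewrite lee_fin.
  - move=> w Uw; apply: le_ereal_inf_tmp => _ [t [t0 Bt] <-].
    rewrite lee_fin ler_nat ltnNge; apply/negP => tn; apply: Uw.
    rewrite /U -(bigcup_mkord n (fun i => B i.+1)).
    by exists t.-1; rewrite /= prednK.
rewrite probability_setC// -(fineK (fin_num_measure P _ mU)) -EFinB -EFinM.
rewrite lee_fin.
have {PU} PU : (fine (P U) <= n%:R * q)%R.
  by rewrite -lee_fin fineK// fin_num_measure.
have nq : (n%:R * q <= 2^-1)%R.
  rewrite -ler_pdivlMr//; apply: le_trans n_le _.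
  by rewrite invfM.
have -> : ((4 * q)^-1 = (2 * q)^-1 * 2^-1)%R by field; rewrite gt_eqF.
apply: ler_pM => //.
- by rewrite invr_ge0 mulr_ge0// ltW.
- exact: ltW.
- lra.
Qed.

End hitting_time.

(** * Tail of the noisy CUSUM *)

Section cusum_tail.
Context {R : realType} {k : nat}.

(** Unlike [cusum], which takes a maximum over starting points, this is the
    recursion on which the induction for the tail bound runs. *)
Fixpoint real_cusum (l : k.-tuple R -> R) (x : nat -> k.-tuple R) (t : nat)
    : R :=
  if t is t'.+1 then Num.max 0 (real_cusum l x t') + l (x t) else 0.

Lemma cusum_real (l : k.-tuple R -> R) (x : nat -> k.-tuple R) (t : nat) :
  cusum (EFin \o l) x t = (real_cusum l x t)%:E.
Proof. by elim: t => [//|t IH]; rewrite cusumS// IH -EFin_max. Qed.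

Lemma measurable_real_cusum {d : measure_display} {T : measurableType d}
    (l : k.-tuple R -> R) (Y : nat -> T -> k.-tuple R) (t : nat) :
  measurable_fun setT l ->
  (forall i, (0 < i <= t)%N -> measurable_fun setT (Y i)) ->
  measurable_fun setT (fun w => real_cusum l (fun i => Y i w) t).
Proof.
move=> ml; elim: t => [|t IH] mY; first exact: measurable_cst.
apply: measurable_funD; last first.
  by apply: measurableT_comp => //; apply: mY; rewrite /= leqnn.
apply: measurable_maxr; first exact: measurable_cst.
by apply: IH => i /andP[i0 it]; apply: mY; rewrite i0 leqW.
Qed.

Local Open Scope ereal_scope.
Context {d : measure_display} {Omega : measurableType d}.
Variable P : probability Omega R.
Variable X : nat -> {RV P >-> k.-tuple R}.
Variable Z : nat -> {RV P >-> R}.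
Variable W : {RV P >-> R}.
Hypothesis indep : mutually_independent P (dp_cusum_sigma X Z W).

Let F : option (nat + nat) -> set (set Omega) := dp_cusum_sigma X Z W.

Let preimage_sub d' (T : measurableType d') (Y : {RV P >-> T}) :
  g_sigma_algebra_preimage Y `<=` measurable.
Proof.
move=> _ [B mB <-]; rewrite setTI -[X in measurable X]setTI.
exact: measurable_funPT.
Qed.

Let preimage_setI d' (T : measurableType d') (Y : Omega -> T) :
  setI_closed (g_sigma_algebra_preimage Y).
Proof.
move=> _ _ [A mA <-] [B mB <-]; exists (A `&` B); first exact: measurableI.
by rewrite !setTI preimage_setI.
Qed.

Let preimage_setT d' (T : measurableType d') (Y : Omega -> T) :
  g_sigma_algebra_preimage Y setT.
Proof. by exists setT => //; rewrite setTI preimage_setT. Qed.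

Let indep_group (J : {fset option (nat + nat)}) (i : option (nat + nat))
    (U V : Omega -> R) :
  i \notin J -> (forall B, measurable B -> F i (V @^-1` B)) ->
  measurable_fun [set: g_sigma_algebraType (\bigcup_(j in [set` J]) F j)] U ->
  independent_funs P U V.
Proof.
move=> iJ FV mU A B mA mB; apply: (mutually_independent_group _ _ _ indep iJ).
- by case=> [[n|n]|]; exact: preimage_sub.
- by case=> [[n|n]|]; exact: preimage_setT.
- by case=> [[n|n]|]; exact: preimage_setI.
- exact: FV.
- by have := mU measurableT B mB; rewrite setTI.
Qed.

(** The index [inl i] stands for X (i + 1), so these are the indices of
    X 1, ..., X t. *)
Let past (t : nat) : {fset option (nat + nat)} :=
  [fset x in [seq Some (inl i) | i <- iota 0 t]]%fset.

Let measurable_past (J : {fset option (nat + nat)}) (t : nat)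
    (l : k.-tuple R -> R) :
  measurable_fun [set: k.-tuple R] l -> {subset past t <= J} ->
  measurable_fun [set: g_sigma_algebraType (\bigcup_(j in [set` J]) F j)]
    (fun w => real_cusum l (fun i => X i w) t).
Proof.
move=> ml sJ; apply: measurable_real_cusum => // -[//|i] /andP[_ it] _ B mB.
apply: sub_sigma_algebra; exists (Some (inl i)).
  by apply: sJ; rewrite inE/=; apply/mapP; exists i; rewrite // mem_iota.
by exists B.
Qed.

(** The increment l (X (t + 1)) is independent of S_t and its exponential has
    mean at most 1, so [exp_tail_add] reproduces the constant 1. *)
Lemma real_cusum_exp_tail (l : k.-tuple R -> R) (t : nat) :
  measurable_fun [set: k.-tuple R] l ->
  (forall i, (0 < i)%N -> \int[P]_w (expR (l (X i w)))%:E <= 1) ->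
  exp_tail P 1 1 (fun w => real_cusum l (fun i => X i w) t).
Proof.
move=> ml El.
have mS s :
    measurable_fun [set: Omega] (fun w => real_cusum l (fun i => X i w) s).
  by apply: measurable_real_cusum => // i _; exact: measurable_funPT.
elim: t => [u|t IH].
  have [u0|u0] := leP u 0%R.
    apply: le_trans (probability_le1 _ _) _.
      by rewrite (_ : [set _ | _] = setT)//; apply/seteqP.
    by rewrite lee_fin !mul1r -expR0 ler_expR oppr_ge0.
  rewrite (_ : [set _ | _] = set0); last first.
    by apply/seteqP; split => w //=; rewrite leNgt u0.
  by rewrite measure0 lee_fin mul1r expR_ge0.
have := @exp_tail_add _ _ _ P 1 1 1
  (fun w => Num.max 0%R (real_cusum l (X ^~ w) t))
  (fun w => l (X t.+1 w)).
rewrite mulr1; apply => //.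
- by apply: measurable_maxr => //; exact: mS.
- by apply: measurableT_comp => //; exact: measurable_funPT.
- apply: (@indep_group (past t) (Some (inl t))).
  + by rewrite inE/=; apply/mapP => -[i + [ti]]; rewrite mem_iota -ti ltnn.
  + move=> B mB; exists (l @^-1` B); last by rewrite setTI.
    by rewrite -[X in measurable X]setTI; exact: ml.
  + by apply: measurable_maxr => //; exact: measurable_past.
- exact: exp_tail_maxr0.
- by under eq_integral do rewrite mul1r; exact: El.
Qed.

(** The CUSUM tail is weakened from rate 1 to rate theta before the noises are
    added: at rate 1 the exponential moment of a Laplace variable may be
    infinite. *)
Lemma noisy_cusum_exp_tail (l : k.-tuple R -> R) (theta M : R) (t : nat) :
  (0 < t)%N -> measurable_fun [set: k.-tuple R] l ->
  (forall i, (0 < i)%N -> \int[P]_w (expR (l (X i w)))%:E <= 1) ->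
  (0 <= theta <= 1)%R -> (0 <= M)%R ->
  \int[P]_w (expR (theta * `|Z t w|))%:E <= M%:E ->
  \int[P]_w (expR (theta * `|W w|))%:E <= M%:E ->
  exp_tail P theta (M * M)
    (fun w => real_cusum l (fun i => X i w) t + Z t w - W w)%R.
Proof.
move=> t0 ml El theta01 M0 EZ EW.
have /andP[theta0 _] := theta01.
have mS :
    measurable_fun [set: Omega] (fun w => real_cusum l (fun i => X i w) t).
  by apply: measurable_real_cusum => // i _; exact: measurable_funPT.
have E_le (V V' : Omega -> R) : measurable_fun [set: Omega] V ->
    measurable_fun [set: Omega] V' -> (forall w, (V' w <= `|V w|)%R) ->
    \int[P]_w (expR (theta * `|V w|))%:E <= M%:E ->
    \int[P]_w (expR (theta * V' w))%:E <= M%:E.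
  move=> mV mV' VV'; apply: le_trans; apply: ge0_le_integral => //.
  - by apply/measurable_EFinP; do 2 apply: measurableT_comp => //.
  - apply/measurable_EFinP; apply: measurableT_comp => //.
    by apply: measurable_funM => //; apply: measurableT_comp.
  - by move=> w _; rewrite lee_fin ler_expR; exact: ler_wpM2l.
have mZ : measurable_fun [set: Omega] (Z t) by exact: measurable_funPT.
have mW : measurable_fun [set: Omega] W by exact: measurable_funPT.
rewrite -{1}(mul1r M); apply: exp_tail_add.
- exact: measurable_funD.
- exact: measurableT_comp.
- apply: (@indep_group (Some (inr t.-1) |` past t)%fset None).
  + by rewrite !inE/=; apply/mapP => -[].
  + move=> B mB; exists (-%R @^-1` B); last by rewrite setTI.
    by rewrite -[X in measurable X]setTI; exact: oppr_measurable.
  + apply: measurable_funD.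
      by apply: measurable_past => // j jp; rewrite fset1Ur.
    move=> _ B mB; apply: sub_sigma_algebra; exists (Some (inr t.-1)).
      by rewrite /= fset1U1.
    by rewrite /F/= prednK//; exists B.
- by rewrite mul1r.
- apply: (@exp_tail_add _ _ _ P theta 1 M _ (Z t)) => //.
  + apply: (@indep_group (past t) (Some (inr t.-1))).
    * by rewrite !inE/=; apply/mapP => -[].
    * by move=> B mB; rewrite /F/= prednK//; exists B; rewrite ?setTI.
    * exact: measurable_past.
  + by apply: (exp_tail_lower mS theta01); exact: real_cusum_exp_tail.
  + by apply: E_le EZ => // w; exact: ler_norm.
- apply: E_le EW => //; first exact: measurableT_comp.
  by move=> w /=; rewrite -normrN ler_norm.
Qed.

End cusum_tail.

(** * The bound on the mean time to a false alarm *)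

Theorem theorem2 (R : realType) (k : nat) (f0 f1 : k.-tuple R -> R)
  (f0_pdf : is_pdf (lebesgue_tuple R k) f0)
  (f1_pdf : is_pdf (lebesgue_tuple R k) f1)
  (f0_neq_f1 : f0 <> f1)
  (Delta : R) (DeltaE : oscillation (llr f0 f1) = Delta%:E)
  (epsilon : R) (epsilon_gt0 : 0 < epsilon)
  (b : R) (b_gt2 : 2 < b)
  (d : measure_display) (Omega : measurableType d) (P : probability Omega R)
  (X : nat -> {RV P >-> k.-tuple R}) (Z : nat -> {RV P >-> R})
  (W : {RV P >-> R})
  (X_law : forall t : nat, (0 < t)%N ->
    has_density (lebesgue_tuple R k) f0 P (X t))
  (Z_law : forall t : nat, (0 < t)%N ->
    has_density lebesgue_measure (laplace_pdf (2 * Delta / epsilon)) P (Z t))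
  (W_law : has_density lebesgue_measure (laplace_pdf (2 * Delta / epsilon))
    P W)
  (indep : mutually_independent P (dp_cusum_sigma X Z W)) :
  ((expR (Num.min (epsilon / (2 * Delta)) 1 * b - 2) / (4 * (b + 1) ^+ 2))%:E
    <= \int[P]_w dp_cusum_time (llr f0 f1) b X Z W w)%E.
Proof.
have [mf0 f0_ge0 _] := f0_pdf; have [mf1 f1_ge0 f1_int] := f1_pdf.
pose l x := ln (f1 x / f0 x).
have pdf_gt0 x : [/\ 0 < f0 x, 0 < f1 x & llr f0 f1 x = (l x)%:E].
  by apply: llr_finE => //; exact: oscillation_fin DeltaE x.
have -> : llr f0 f1 = EFin \o l by apply/funext => x; have [] := pdf_gt0 x.
have ml : measurable_fun [set: k.-tuple R] l.
  have -> : l = (fun x => ln (f1 x) - ln (f0 x)).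
    by apply/funext => x; have [? ? _] := pdf_gt0 x; rewrite /l ln_div ?posrE.
  by apply: measurable_funB; exact: measurableT_comp.
have El i : (0 < i)%N -> (\int[P]_w (expR (l (X i w)))%:E <= 1)%E.
  move=> i0.
  rewrite (has_density_expectation (g := fun x => (expR (l x))%:E)
    _ _ _ (X_law i i0))//.
  - rewrite -f1_int le_eqVlt; apply/orP; left; apply/eqP.
    apply: eq_integral => x _; have [f0x f1x _] := pdf_gt0 x.
    by rewrite -EFinM /l lnK ?posrE ?divr_gt0// divfK// gt_eqF.
  - by apply/measurable_EFinP; exact: measurableT_comp.
set beta := 2 * Delta / epsilon in Z_law W_law.
have beta_gt0 : 0 < beta.
  rewrite lt_neqAle eq_sym (laplace_scale_neq0 W_law)/=.
  rewrite divr_ge0//; last exact: ltW.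
  rewrite mulr_ge0// -lee_fin -DeltaE.
  pose x0 : k.-tuple R := [tuple of nseq k 0].
  apply: (@le_trans _ _ (`|llr f0 f1 x0 - llr f0 f1 x0|%E)).
    exact: abse_ge0.
  by apply: ereal_sup_ubound; exists x0 => //; exists x0.
have -> : epsilon / (2 * Delta) = beta^-1 by rewrite /beta invf_div.
set h := Num.min beta^-1 1.
have h_gt0 : 0 < h by rewrite lt_min invr_gt0 beta_gt0 ltr01.
have h_le1 : h <= 1 by rewrite ge_min lexx orbT.
have hbeta : h * beta <= 1 by rewrite -ler_pdivlMr// div1r ge_min lexx.
have b1_gt0 : 0 < b + 1 by lra.
(* Just below h: it keeps the Laplace moments at most b + 1 and
   loses only a factor e in exp (- h b). *)
pose theta := h * (b / (b + 1)).
have r01 : 0 <= b / (b + 1) <= 1.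
  by rewrite divr_ge0 ?ler_pdivrMr//; lra.
have [r_ge0 r_le1] := andP r01.
have theta_ge0 : 0 <= theta by rewrite mulr_ge0// ltW.
have theta_le1 : theta <= 1 by rewrite mulr_ile1// ltW.
have theta_beta : theta * beta <= 1 - (b + 1)^-1.
  have -> : 1 - (b + 1)^-1 = b / (b + 1) by field; rewrite gt_eqF.
  by rewrite /theta mulrAC ler_piMl.
have b1V_gt0 : 0 < (b + 1)^-1 by rewrite invr_gt0.
have EV (V : {RV P >-> R}) :
    has_density lebesgue_measure (laplace_pdf beta) P V ->
    (\int[P]_w (expR (theta * `|V w|))%:E <= (b + 1)%:E)%E.
  move=> V_law.
  rewrite (laplace_expectation_expR_abs _ _ _ V_law)//; last by lra.
  rewrite lee_fin invf_ple ?posrE//; lra.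
pose q := (b + 1) ^+ 2 * expR (2 - h * b).
have q_gt0 : 0 < q by rewrite mulr_gt0 ?expR_gt0// exprn_gt0.
have -> : expR (h * b - 2) / (4 * (b + 1) ^+ 2) = (4 * q)^-1.
  rewrite /q -(opprB (h * b)) expRN; field.
  by rewrite ?gt_eqF//= expR_gt0.
pose B t := [set w | b <= real_cusum l (fun i => X i w) t + Z t w - W w].
have mB t : measurable (B t).
  apply: measurable_superlevel; apply: measurable_funB => //.
  apply: measurable_funD => //.
  by apply: measurable_real_cusum.
have PB t : (0 < t)%N -> (P (B t) <= q%:E)%E.
  move=> t0; have := noisy_cusum_exp_tail indep t0 ml El _ _
    (EV _ (Z_law t t0)) (EV _ W_law) b.
  rewrite theta_ge0 theta_le1 => /(_ isT (ltW b1_gt0)) /le_trans; apply.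
  rewrite lee_fin /q -expr2 ler_pM2l ?exprn_gt0// ler_expR.
  have -> : theta * b = h * b - h * (b / (b + 1)).
    by rewrite /theta; field; rewrite gt_eqF.
  rewrite -/theta; lra.
apply: le_trans (expected_hitting_time_ge q_gt0 mB PB) _.
rewrite le_eqVlt; apply/orP; left; apply/eqP; apply: eq_integral => w _.
congr ereal_inf; apply/seteqP.
split => _ [t [t0 Bt] <-]; exists t => //; split => //;
  by move: Bt; rewrite /B/= cusum_real -EFinD lee_fin lerBrDr.
Qed.
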